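(* Consider the three-dimensional canonical fusion bialgebras $(\mathcal{A},\mathcal{B},\mathfrak{F},d,\tau)$ with self-adjoint basis elements, parameterized by $d_2,d_3\ge1$ and $0\le a\le1$ (with $b=1-a$, $d_2^2-1-ad_3^2\ge0$, $d_3^2-1-bd_2^2\ge0$), where $\mathcal{B}$ has $\mathbb{R}_{\ge0}$-basis $\{x_1=1,x_2,x_3\}$, $x_j^*=x_j$, and $$x_2x_2=x_1+\frac{d_2^2-1-a d_3^2}{d_2}x_2+a d_3 x_3,\qquad x_2x_3=x_3x_2=a d_3x_2+b d_2x_3,\qquad x_3x_3=x_1+b d_2x_2+\frac{d_3^2-1-b d_2^2}{d_3}x_3.$$ The Schur product property does not hold on the dual in general for these fusion bialgebras; for example, it fails for $d_2=1000$, $d_3=500$, $a=0.750001$, i.e. in that case there are $x,y\ge0$ in $\mathcal{B}$ such that $x*_{\mathcal{B}}y$ is not $\ge0$.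
   Context: $\mathcal{B}$ is the $C^*$-algebra (acting by left multiplication on $L^2(\mathcal{B},\tau)$) with the given product, where $\tau(x_j)=\delta_{j,1}$ is a faithful tracial state, and $d$ is the linear functional with $d(x_1)=1$, $d(x_2)=d_2$, $d(x_3)=d_3$ (the operator norm of left multiplication by $x_j$). $\mathcal{A}$ is the commutative $C^*$-algebra with the same linear basis, multiplication $x_j\diamond x_k=\delta_{j,k}d(x_j)^{-1}x_j$ and anti-linear involution $x_j^{\#}=x_j$, with trace $d$; and $\mathfrak{F}:\mathcal{A}\to\mathcal{B}$ is the linear map $\mathfrak{F}(x_j)=x_j$. An $\mathbb{R}_{\ge0}$-basis is a linear basis containing $1$, stable under $*$, with non-negative structure constants $N_{j,k}^s$ satisfying $N_{j,k}^1=\delta_{j,k^*}$, where $x_k^*=x_{k^*}$. The convolution on $\mathcal{B}$ is $x*_{\mathcal{B}}y:=\big(\mathfrak{F}(\mathfrak{F}^{-1}(y^* )\diamond\mathfrak{F}^{-1}(x^* ))\big)^*$. The Schur product property holds on the dual (equivalently on $\mathcal{B}$) if $x*_{\mathcal{B}}y\ge0$ for all $x,y\ge0$ in $\mathcal{B}$. *)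

(* Defs.v *)
From HB Require Import structures.
From mathcomp Require Import all_boot all_order all_algebra.
From mathcomp Require Import ring lra.
From mathcomp Require Import reals complex.

Set Implicit Arguments.
Unset Strict Implicit.
Unset Printing Implicit Defensive.
Import Order.TTheory GRing.Theory Num.Theory.
Local Open Scope ring_scope.
Local Open Scope complex_scope.

Record fusion3 (R : realType) := Fusion3 {
  d2 : R;
  d3 : R;
  a : R;
  d2_ge1 : 1 <= d2;
  d3_ge1 : 1 <= d3;
  a_ge0 : 0 <= a;
  a_le1 : a <= 1;
  N222_ge0 : 0 <= d2 ^+ 2 - 1 - a * d3 ^+ 2;
  N333_ge0 : 0 <= d3 ^+ 2 - 1 - (1 - a) * d2 ^+ 2 }.

(* A and B have the same underlying vector space, given by the coordinates on
   x_1, x_2, x_3, but carry different products. *)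
Definition A (R : realType) (p : fusion3 R) : Type := 'rV[R[i]]_3.
Definition B (R : realType) (p : fusion3 R) : Type := 'rV[R[i]]_3.

HB.instance Definition _ (R : realType) (p : fusion3 R) :=
  GRing.Lmodule.copy (A p) 'rV[R[i]]_3.
HB.instance Definition _ (R : realType) (p : fusion3 R) :=
  GRing.Lmodule.copy (B p) 'rV[R[i]]_3.

Section FusionBialgebra.
Variables (R : realType) (p : fusion3 R).
Implicit Types j k s : 'I_3.

Local Notation C := R[i].
Local Notation d2 := (d2 p).
Local Notation d3 := (d3 p).
Local Notation a := (a p).

Definition b : R := 1 - a.

(* The basis elements x_1, x_2, x_3 carry the indices 0, 1, 2. *)
Definition dval j : R := nth 0 [:: 1; d2; d3] j.

(* N j k s is the coefficient of the s-th basis element in the product of the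
   j-th and the k-th one. *)
Definition N j k s : R :=
  nth 0 (nth [::] (nth [::]
    [:: [:: [:: 1; 0; 0];
            [:: 0; 1; 0];
            [:: 0; 0; 1]];
        [:: [:: 0; 1; 0];
            [:: 1; (d2 ^+ 2 - 1 - a * d3 ^+ 2) / d2; a * d3];
            [:: 0; a * d3; b * d2]];
        [:: [:: 0; 0; 1];
            [:: 0; a * d3; b * d2];
            [:: 1; b * d2; (d3 ^+ 2 - 1 - b * d2 ^+ 2) / d3]]] j) k) s.

Local Notation A := (A p).
Local Notation B := (B p).

Definition mulB (x y : B) : B :=
  \row_s \sum_j \sum_k x 0 j * y 0 k * (N j k s)%:C.
Definition oneB : B := delta_mx 0 0.

(* x_j <> x_k = delta_(j,k) d(x_j)^-1 x_j, extended bilinearly *)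
Definition mulA (x y : A) : A := \row_j (x 0 j * y 0 j / (dval j)%:C).
Definition oneA : A := \row_j (dval j)%:C.

Lemma dval_neq0 j : dval j != 0.
Proof.
have h2 := d2_ge1 p; have h3 := d3_ge1 p; apply: lt0r_neq0.
by case: j => [[|[|[|//]]]] ?; rewrite /dval /=; lra.
Qed.

Lemma N_ge0 j k s : 0 <= N j k s.
Proof.
have h2 := d2_ge1 p; have h3 := d3_ge1 p; have a0 := a_ge0 p.
have a1 := a_le1 p; have n2 := N222_ge0 p; have n3 := N333_ge0 p.
case: j => [[|[|[|//]]]] ?; case: k => [[|[|[|//]]]] ?;
  case: s => [[|[|[|//]]]] ?; rewrite /N /b /= ?mulr_ge0 ?invr_ge0 //; lra.
Qed.

Lemma sumE3 (V : nmodType) (f : 'I_3 -> V) :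
  \sum_j f j = f 0 + f 1 + f 2%:R.
Proof.
rewrite !big_ord_recl big_ord0 addr0 addrA; congr (f _ + f _ + f _); exact: val_inj.
Qed.

Lemma rV3P (x y : 'rV[C]_3) :
  [/\ x 0 0 = y 0 0, x 0 1 = y 0 1 & x 0 2%:R = y 0 2%:R] -> x = y.
Proof.
case=> e0 e1 e2; apply/rowP => -[[|[|[|//]]]] lt_i.
- by have -> : Ordinal lt_i = 0 by apply: val_inj.
- by have -> : Ordinal lt_i = 1 by apply: val_inj.
- by have -> : Ordinal lt_i = 2%:R by apply: val_inj.
Qed.

Lemma mulAA : associative mulA.
Proof.
by move=> u v w; apply/rowP => j; rewrite !mxE -!mulrA; congr (_ * _);
  rewrite mulrCA mulrC -!mulrA [_^-1 * w _ _]mulrC.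
Qed.

Lemma mulAC : commutative mulA.
Proof. by move=> u v; apply/rowP => j; rewrite !mxE [u _ _ * _]mulrC. Qed.

Lemma mul1A : left_id oneA mulA.
Proof.
move=> u; apply/rowP => j; rewrite !mxE mulrAC divff ?mul1r //.
by rewrite fmorph_eq0 dval_neq0.
Qed.

Lemma mulADl : left_distributive mulA +%R.
Proof. by move=> u v w; apply/rowP => j; rewrite !mxE !mulrDl. Qed.

Lemma oneA_neq0 : oneA != 0.
Proof.
apply/eqP => /rowP /(_ 0); rewrite !mxE => /eqP.
by rewrite fmorph_eq0 (negPf (dval_neq0 0)).
Qed.

HB.instance Definition _ := GRing.Zmodule_isComNzRing.Build A
  mulAA mulAC mul1A mulADl oneA_neq0.

Lemma scaleAAl (c : C) (u v : A) : c *: (u * v) = (c *: u) * v.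
Proof. by apply/rowP => j; rewrite !mxE !mulrA. Qed.

HB.instance Definition _ := GRing.Lmodule_isLalgebra.Build C A scaleAAl.
HB.instance Definition _ := GRing.Lalgebra_isComAlgebra.Build C A.

Lemma mulB_coord (u v : B) :
  let: (u1, u2, u3) := (u 0 0, u 0 1, u 0 2%:R) in
  let: (v1, v2, v3) := (v 0 0, v 0 1, v 0 2%:R) in
  [/\ mulB u v 0 0 = u1 * v1 + u2 * v2 + u3 * v3,
      mulB u v 0 1 = u1 * v2 + u2 * v1
        + u2 * v2 * ((d2 ^+ 2 - 1 - a * d3 ^+ 2) / d2)%:C
        + (u2 * v3 + u3 * v2) * (a * d3)%:C + u3 * v3 * (b * d2)%:C
    & mulB u v 0 2%:R = u1 * v3 + u3 * v1 + u2 * v2 * (a * d3)%:C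
        + (u2 * v3 + u3 * v2) * (b * d2)%:C
        + u3 * v3 * ((d3 ^+ 2 - 1 - b * d2 ^+ 2) / d3)%:C].
Proof.
by split; rewrite !mxE !sumE3 /N /= ?(rmorph0, rmorph1, mulr0, mulr1)
    ?addr0 ?add0r;
  ring.
Qed.

Lemma mulBC : commutative mulB.
Proof.
move=> u v; have [e1 e2 e3] := mulB_coord u v.
have [f1 f2 f3] := mulB_coord v u.
by apply: rV3P; split; rewrite ?e1 ?e2 ?e3 ?f1 ?f2 ?f3; ring.
Qed.

Lemma mulBA : associative mulB.
Proof.
have h2 : d2%:C != 0 by rewrite fmorph_eq0 (dval_neq0 1).
have h3 : d3%:C != 0 by rewrite fmorph_eq0 (dval_neq0 2%:R).
move=> u v w; have [e1 e2 e3] := mulB_coord v w.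
have [f1 f2 f3] := mulB_coord u v.
have [g1 g2 g3] := mulB_coord u (mulB v w).
have [k1 k2 k3] := mulB_coord (mulB u v) w.
apply: rV3P; split; rewrite ?g1 ?g2 ?g3 ?k1 ?k2 ?k3 ?e1 ?e2 ?e3 ?f1 ?f2 ?f3
  /b; field; exact/andP.
Qed.

Lemma mul1B : left_id oneB mulB.
Proof.
move=> u; have [e1 e2 e3] := mulB_coord oneB u.
by apply: rV3P; split; rewrite ?e1 ?e2 ?e3 !mxE /=; ring.
Qed.

Lemma mulBDl : left_distributive mulB +%R.
Proof.
move=> u v w; have [e1 e2 e3] := mulB_coord u w.
have [f1 f2 f3] := mulB_coord v w.
have [g1 g2 g3] := mulB_coord (u + v) w.
by apply: rV3P; split; rewrite [RHS]mxE ?e1 ?e2 ?e3 ?f1 ?f2 ?f3 ?g1 ?g2 ?g3 !mxE;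
  ring.
Qed.

Lemma oneB_neq0 : oneB != 0.
Proof. by apply/eqP => /rowP /(_ 0); rewrite !mxE => /eqP; rewrite oner_eq0. Qed.

HB.instance Definition _ := GRing.Zmodule_isComNzRing.Build B
  mulBA mulBC mul1B mulBDl oneB_neq0.

Lemma scaleBAl (c : C) (u v : B) : c *: mulB u v = mulB (c *: u) v.
Proof.
have [e1 e2 e3] := mulB_coord u v; have [f1 f2 f3] := mulB_coord (c *: u) v.
by apply: rV3P; split; rewrite [LHS]mxE ?e1 ?e2 ?e3 ?f1 ?f2 ?f3 !mxE; ring.
Qed.

HB.instance Definition _ := GRing.Lmodule_isLalgebra.Build C B scaleBAl.
HB.instance Definition _ := GRing.Lalgebra_isComAlgebra.Build C B.

Definition x j : B := delta_mx 0 j.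

Definition star (u : B) : B := \row_j (u 0 j)^*.
Definition sharp (u : A) : A := \row_j (u 0 j)^*.

Definition tau (u : B) : C := u 0 0.
Definition d (u : A) : C := \sum_j u 0 j * (dval j)%:C.

(* The identity on coordinates, i.e. F(x_j) = x_j. *)
Definition F (u : A) : B := u.
Definition Finv (u : B) : A := u.

Lemma x_unit : x 0 = 1.
Proof. by []. Qed.

Lemma x_mul j k : x j * x k = \sum_s (N j k s)%:C *: x s.
Proof.
apply/rowP => s; rewrite mxE (bigD1 j) //= [X in _ + X]big1 ?addr0.
  rewrite (bigD1 k) //= [X in _ + X]big1 ?addr0.
    rewrite summxE (bigD1 s) //= [X in _ = _ + X]big1 ?addr0.
      by rewrite !mxE !eqxx !mul1r mulr1.
    by move=> t /negPf; rewrite !mxE eqxx eq_sym => ->; rewrite mulr0.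
  by move=> t /negPf; rewrite !mxE eqxx => ->; rewrite mulr0 mul0r.
by move=> t /negPf t_j; rewrite big1 // => t' _; rewrite !mxE t_j andbF !mul0r.
Qed.

Lemma x_mul22 : x 1 * x 1 = x 0
  + ((d2 ^+ 2 - 1 - a * d3 ^+ 2) / d2)%:C *: x 1 + (a * d3)%:C *: x 2%:R.
Proof. by rewrite x_mul sumE3 /N /= scale1r. Qed.

Lemma x_mul23 : x 1 * x 2%:R = (a * d3)%:C *: x 1 + (b * d2)%:C *: x 2%:R.
Proof. by rewrite x_mul sumE3 /N /= scale0r add0r. Qed.

Lemma x_mul33 : x 2%:R * x 2%:R = x 0
  + (b * d2)%:C *: x 1 + ((d3 ^+ 2 - 1 - b * d2 ^+ 2) / d3)%:C *: x 2%:R.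
Proof. by rewrite x_mul sumE3 /N /= scale1r. Qed.

Lemma x_mulA j k : Finv (x j) * Finv (x k)
  = if j == k then (dval j)%:C^-1 *: Finv (x j) else 0.
Proof.
apply/rowP => s; rewrite !mxE /=; case: (eqVneq j k) => [<-|j_k];
  case: (eqVneq s j) => [->|s_j]; rewrite ?mxE ?eqxx ?(negPf s_j) ?(negPf j_k) /=
    ?mul0r ?mulr0 ?mul1r ?mulr1 ?mul0r //.
Qed.

Lemma N_one j k : N j k 0 = (j == k)%:R.
Proof.
by case: j => [[|[|[|//]]]] ?; case: k => [[|[|[|//]]]] ?; rewrite /N /=.
Qed.

Lemma star_x j : star (x j) = x j.
Proof. by apply/rowP => s; rewrite !mxE rmorph_nat. Qed.

Lemma starK : involutive star.
Proof. by move=> u; apply/rowP => j; rewrite !mxE conjcK. Qed.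

Lemma starM (u v : B) : star (u * v) = star v * star u.
Proof.
rewrite [RHS]mulrC; apply/rowP => s; rewrite !mxE rmorph_sum.
apply: eq_bigr => j _; rewrite rmorph_sum; apply: eq_bigr => k _.
by rewrite !rmorphM !mxE; congr (_ * _); exact: conjc_real.
Qed.

Lemma tau_x j : tau (x j) = (j == 0)%:R.
Proof. by rewrite /tau mxE eqxx eq_sym. Qed.

Lemma tau_norm2 (u : B) : tau (star u * u) = \sum_j (u 0 j)^* * u 0 j.
Proof.
rewrite /tau mxE; apply: eq_bigr => j _; rewrite (bigD1 j) //= big1 ?addr0.
  by rewrite N_one eqxx mulr1 mxE.
by move=> k /negPf; rewrite N_one eq_sym => ->; rewrite mulr0.
Qed.

Lemma d_x j : d (Finv (x j)) = (dval j)%:C.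
Proof.
rewrite /d (bigD1 j) //= big1 ?addr0 ?mxE ?eqxx ?mul1r //.
by move=> k /negPf; rewrite mxE => ->; rewrite mul0r.
Qed.

(* F is unitary from L^2(A, d) to L^2(B, tau). *)
Lemma F_unitary (u v : A) : tau (star (F u) * F v) = d (sharp u * v).
Proof.
rewrite /tau mxE; apply: eq_bigr => j _; rewrite (bigD1 j) //= big1 ?addr0.
  rewrite N_one eqxx mulr1 !mxE mulfVK //.
  by rewrite fmorph_eq0 dval_neq0.
by move=> k /negPf; rewrite N_one eq_sym => ->; rewrite mulr0.
Qed.

Definition convB (u v : B) : B := star (F (Finv (star v) * Finv (star u))).

(* u >= 0 in the C*-algebra B *)
Definition posB (u : B) : Prop := exists w : B, u = star w * w.

Definition schur_product_dual : Prop :=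
  forall u v : B, posB u -> posB v -> posB (convB u v).

End FusionBialgebra.

Arguments x {R} p j.

(* Main.v *)
(* Write conv for the convolution.  For u >= 0 the functional y |-> tau(u y) is
   positive, since tau(w^* w v^* v) = tau((w v)^* (w v)), and
   tau(u conv(v, w)) = sum_j u_j v_j w_j / d_j.  Hence conv(u, u) >= 0 forces
   sum_j u_j^3 / d_j >= 0 when u has real coordinates.  Besides
   (x_2, x_3) |-> (1000, 500), the characters of B are approximately
   (-0.004, 0.006) and (62.5, -125); an element u concentrated on the last one
   has a very negative x_3-coordinate.  The element x_2 - 2 x_3 vanishes at the
   first character and nearly vanishes at the second; its square
   u = 5 + 312.49275 x_2 - 624.9955 x_3 violates the inequality. *)
Require Import Defs.
From mathcomp Require Import all_boot all_order all_algebra.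
From mathcomp Require Import reals complex.
From mathcomp Require Import ring lra.
Import Order.TTheory GRing.Theory Num.Theory.
Local Open Scope ring_scope.

Lemma tau_mul (R : realType) (p : fusion3 R) (u v : B p) :
  tau (u * v) = \sum_j u 0 j * v 0 j.
Proof.
rewrite /tau mxE; apply: eq_bigr => j _; rewrite (bigD1 j) //= big1 ?addr0.
  by rewrite N_one eqxx mulr1.
by move=> k /negPf; rewrite N_one eq_sym => ->; rewrite mulr0.
Qed.

Lemma tau_mul_ge0 (R : realType) (p : fusion3 R) (u v : B p) :
  posB u -> posB v -> 0 <= tau (u * v).
Proof.
move=> [w ->] [z ->].
(* Commutativity of [B] regroups the factors. *)
have -> : star w * w * (star z * z) = star (w * z) * (w * z) :> B p.
  by rewrite starM; ring.
rewrite tau_norm2; apply: sumr_ge0 => j _.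
by rewrite mulrC; exact: mul_conjC_ge0.
Qed.

(** The conjugations cancel because [dval] is real; the swapped factors commute in [A]. *)
Lemma convBE (R : realType) (p : fusion3 R) (u v : B p) j :
  convB u v 0 j = u 0 j * v 0 j / (dval p j)%:C%C.
Proof.
rewrite !mxE -fmorphV !rmorphM [X in X * _]mulrC; congr (_ * _ * _).
- exact: conjcK.
- exact: conjcK.
- exact: conjc_real.
Qed.

Lemma posB_convB_diag (R : realType) (p : fusion3 R) (u : B p) (r : 'I_3 -> R) :
  (forall j, u 0 j = (r j)%:C%C) -> posB u -> posB (convB u u) ->
  0 <= \sum_j r j ^+ 3 / dval p j.
Proof.
move=> ur u_pos c_pos; rewrite -lecR rmorph0.
have := tau_mul_ge0 _ _ _ _ u_pos c_pos; rewrite tau_mul; congr (0 <= _).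
rewrite rmorph_sum; apply: eq_bigr => j _.
by rewrite convBE ur -!rmorphM -fmorphV -!rmorphM; congr (_%:C%C); ring.
Qed.

Definition x2_sub_2x3 (R : realType) (p : fusion3 R) : B p :=
  x p 1 - 2%:R *: x p 2%:R.

Lemma star_x2_sub_2x3 (R : realType) (p : fusion3 R) :
  star (x2_sub_2x3 R p) = x2_sub_2x3 R p.
Proof. by apply/rowP => j; rewrite !mxE rmorphB rmorphM !rmorph_nat. Qed.

(** Kept in [R] rather than [R[i]], so that the final inequality is real arithmetic. *)
Definition sqr_coord (R : realType) (p : fusion3 R) (j : 'I_3) : R :=
  nth 0 [:: 5;
    (d2 p ^+ 2 - 1 - a p * d3 p ^+ 2) / d2 p - 4 * (a p * d3 p)
      + 4 * (b p * d2 p);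
    a p * d3 p - 4 * (b p * d2 p)
      + 4 * ((d3 p ^+ 2 - 1 - b p * d2 p ^+ 2) / d3 p)] j.

Lemma sqr_coordE (R : realType) (p : fusion3 R) (j : 'I_3) :
  (x2_sub_2x3 R p * x2_sub_2x3 R p) 0 j = (sqr_coord R p j)%:C%C.
Proof.
suff -> : x2_sub_2x3 R p * x2_sub_2x3 R p = \row_k (sqr_coord R p k)%:C%C.
  by rewrite mxE.
have [e1 e2 e3] := mulB_coord (x2_sub_2x3 R p) (x2_sub_2x3 R p).
by apply: rV3P; split; rewrite ?e1 ?e2 ?e3 !mxE /sqr_coord /=; ring.
Qed.

Theorem theorem3p8 (R : realType) :
  ~ (forall p : fusion3 R, schur_product_dual p) /\
  exists p : fusion3 R,
    [/\ d2 p = 1000, d3 p = 500, a p = 750001%:R / 1000000%:R &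
      exists x y : B p, [/\ posB x, posB y & ~ posB (convB x y)]].
Proof.
suff ex : exists p : fusion3 R,
    [/\ d2 p = 1000, d3 p = 500, a p = 750001%:R / 1000000%:R &
      exists x y : B p, [/\ posB x, posB y & ~ posB (convB x y)]].
  split=> // schur; have [p [_ _ _ [u [v [u_pos v_pos]]]]] := ex.
  by apply; exact: schur.
have [p [e2 e3 ea]] : exists p : fusion3 R,
    [/\ d2 p = 1000, d3 p = 500 & a p = 750001%:R / 1000000%:R].
  (* [N333_ge0] is tight here: 500^2 - 1 = 0.249999 * 1000^2. *)
  by unshelve eexists (@Fusion3 R 1000 500 (750001%:R / 1000000%:R) _ _ _ _ _ _);
    [lra .. | split].
exists p; split=> //; pose u := x2_sub_2x3 R p * x2_sub_2x3 R p.
have u_pos : posB u by exists (x2_sub_2x3 R p); rewrite star_x2_sub_2x3.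
exists u, u; split=> // /(posB_convB_diag _ _ _ _ (sqr_coordE R p) u_pos).
(* The sum is about 125 + 30515 - 488271 < 0. *)
by rewrite sumE3 /sqr_coord /dval /b /= e2 e3 ea; lra.
Qed.
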